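(* For each integer $n\ge 1$ let $g_n(z)=\sum_{k=0}^{n-1}e^{\pi i k^2/n}\,z^k$. Then \[ \lim_{n\to\infty}\frac{\lVert g_n\rVert_4^4-\lVert g_n\rVert_2^4}{\lVert g_n\rVert_2^3}=\frac{2}{\pi}. \]
   Context: For real $r\ge 1$, the $L^r$ norm of a polynomial $f\in\mathbb{C}[z]$ on the unit circle is \[ \lVert f\rVert_r=\bigg(\frac{1}{2\pi}\int_0^{2\pi}\lvert f(e^{i\theta})\rvert^r\,d\theta\bigg)^{1/r}. \] *)

(* Defs.v *)
From mathcomp Require Import all_boot all_order all_algebra.
From mathcomp Require Export complex.
From mathcomp Require Import all_classical all_reals all_analysis.

Set Implicit Arguments.
Unset Strict Implicit.
Unset Printing Implicit Defensive.

Import GRing.Theory Num.Theory numFieldNormedType.Exports.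
Local Open Scope ring_scope.

(* e^(i t), for real t *)
Definition expi (R : realType) (t : R) : R[i] := (cos t +i* sin t)%C.

(* ComplexField.Normc.normc is the complex modulus with values in R; the norm
   `|z| of R[i] is R[i]-valued and could not be integrated directly. *)
Definition circle_norm (R : realType) (r : R) (f : {poly R[i]}) : R :=
  ((2 * pi)^-1 *
   \int[lebesgue_measure]_(t in `[0%R, (2 * pi)%R]%classic)
     (ComplexField.Normc.normc f.[expi t] `^ r)) `^ r^-1.

(* For n = 0 this is the zero polynomial. *)
Definition g_poly (R : realType) (n : nat) : {poly R[i]} :=
  \sum_(0 <= k < n) expi (pi * (k ^ 2)%:R / n%:R) *: 'X^k.

(* Main.v *)
Require Import Defs.
From mathcomp Require Import all_boot all_order all_algebra.
From mathcomp Require Import all_classical all_reals all_analysis.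
From mathcomp Require Import measurable_realfun.
From mathcomp Require Import zify ring lra.

(** The [u]-th aperiodic autocorrelation of the coefficients of [g_n] is a
    geometric sum of modulus [|sin (pi u^2 / n) / sin (pi u / n)|], so by
    orthogonality [||g_n||_2^2 = n] and
    [||g_n||_4^4 = n^2 + 2 sum_(1 <= u < n) (sin (pi u^2 / n) / sin (pi u / n))^2].
    The sum is symmetric under [u -> n - u]; each half, with step
    [d = sqrt (pi / n)] and nodes [x = u d], is up to the factor [d^-3] a Riemann
    sum which converges, by dominated convergence, to
    [J = int_0^oo sin(x^2)^2 / x^2 dx]. Finally [J = sqrt pi / 2]: writing
    [1 / x^3] as a multiple of [int_0^oo y^2 exp(- x^2 y^2) dy] and exchanging
    the integrals (Tonelli) leaves the rational integral
    [int_0^oo dy / (y^4 + 4) = pi / 8]. *)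

Import Order.TTheory GRing.Theory Num.Theory.
Import numFieldNormedType.Exports.
Local Open Scope classical_set_scope.
Local Open Scope ring_scope.

(** * Derivation rules and improper integrals *)

(* The [is_derive] instances of the library are about pointwise operations on
   functions; stated for lambda-terms they can be chained by unification. *)
Section derivation_rules.
Context {R : realType}.
Implicit Types (f g : R -> R) (x a b c : R).

Lemma derive_rule_cst x c : is_derive x (1 : R) (fun=> c) (0 : R).
Proof. exact: is_derive_cst. Qed.

Lemma derive_rule_id x : is_derive x (1 : R) (fun y => y) (1 : R).
Proof. exact: is_derive_id. Qed.

Lemma derive_ruleD f g x a b : is_derive x (1 : R) f a ->
  is_derive x (1 : R) g b -> is_derive x (1 : R) (fun y => f y + g y) (a + b).
Proof. exact: is_deriveD. Qed.

Lemma derive_ruleN f x a : is_derive x (1 : R) f a ->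
  is_derive x (1 : R) (fun y => - f y) (- a).
Proof. exact: is_deriveN. Qed.

Lemma derive_ruleM f g x a b : is_derive x (1 : R) f a ->
  is_derive x (1 : R) g b ->
  is_derive x (1 : R) (fun y => f y * g y) (f x * b + g x * a).
Proof. exact: is_deriveM. Qed.

Lemma derive_ruleX f n x a : is_derive x (1 : R) f a ->
  is_derive x (1 : R) (fun y => f y ^+ n) (n%:R * f x ^+ n.-1 * a).
Proof.
by move=> df; have := is_deriveX n df; rewrite exprfctE.
Qed.

Lemma derive_rule_comp (h h' f : R -> R) x a :
  is_derive (f x) (1 : R) h (h' (f x)) -> is_derive x (1 : R) f a ->
  is_derive x (1 : R) (fun y => h (f y)) (h' (f x) * a).
Proof. by move=> dh df; apply: (@is_derive1_comp _ h f). Qed.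

Lemma derive_ruleV f x a : f x != 0 -> is_derive x (1 : R) f a ->
  is_derive x (1 : R) (fun y => (f y)^-1) (- f x ^- 2 * a).
Proof. by move=> fx df; apply: is_deriveV. Qed.

Lemma derive_rule_sin f x a : is_derive x (1 : R) f a ->
  is_derive x (1 : R) (fun y => sin (f y)) (cos (f x) * a).
Proof. exact: derive_rule_comp. Qed.

Lemma derive_rule_cos f x a : is_derive x (1 : R) f a ->
  is_derive x (1 : R) (fun y => cos (f y)) (- sin (f x) * a).
Proof. exact: (derive_rule_comp cos (fun y => - sin y)). Qed.

Lemma derive_rule_expR f x a : is_derive x (1 : R) f a ->
  is_derive x (1 : R) (fun y => expR (f y)) (expR (f x) * a).
Proof. exact: derive_rule_comp. Qed.

Lemma derive_rule_ln f x a : 0 < f x -> is_derive x (1 : R) f a ->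
  is_derive x (1 : R) (fun y => ln (f y)) ((f x)^-1 * a).
Proof.
by move=> fx0; apply: (derive_rule_comp (@ln R) (fun y => y^-1)); exact: is_derive1_ln.
Qed.

Lemma derive_rule_atan f x a : is_derive x (1 : R) f a ->
  is_derive x (1 : R) (fun y => atan (f y)) ((1 + f x ^+ 2)^-1 * a).
Proof. exact: (derive_rule_comp (@atan R) (fun y => (1 + y ^+ 2)^-1)). Qed.

Lemma derivable_continuous f : (forall x, derivable f x 1) -> continuous f.
Proof. by move=> df x; apply/differentiable_continuous/derivable1_diffP. Qed.

Lemma is_derive_continuous f f' :
  (forall x, is_derive x (1 : R) f (f' x)) -> continuous f.
Proof. by move=> df; apply: derivable_continuous => x; exact: ex_derive. Qed.

End derivation_rules.

Ltac derive_rules := repeat first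
  [ apply: derive_rule_cst | apply: derive_rule_id | eapply derive_ruleD
  | eapply derive_ruleN | eapply derive_ruleM | eapply derive_ruleX
  | eapply derive_rule_sin | eapply derive_rule_cos | eapply derive_rule_expR
  | eapply derive_rule_atan | eapply derive_rule_ln | eapply derive_ruleV ].

Ltac prove_derive := eapply is_derive_eq; [derive_rules | ].

Lemma ge0_FTC2_0y (R : realType) (f F : R -> R) (l : R) :
  (forall x, 0 <= x -> 0 <= f x) -> continuous f ->
  (forall x : R, is_derive x (1 : R) F (f x)) -> F x @[x --> +oo] --> l ->
  (\int[lebesgue_measure]_(x in `[0%R, +oo[) (f x)%:E = (l - F 0)%:E)%E.
Proof.
move=> f0 cf dF Fl.
have cF : continuous F by exact: is_derive_continuous dF.
rewrite (@ge0_continuous_FTC2y _ f F 0 l) ?EFinB//.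
- exact: continuous_subspaceT.
- by apply: cvg_at_right_filter; exact: cF.
- by move=> x _; rewrite derive1E derive_val.
Qed.

Lemma sqrD4_gt0 (R : realType) (y : R) : 0 < y ^+ 4 + 4.
Proof. by rewrite ltr_wpDl// exprn_even_ge0. Qed.

Lemma cvgy_bounded_decay (R : realType) (F : R -> R) (l C : R) :
  (forall x, 1 <= x -> `|F x - l| <= C / x) -> F x @[x --> +oo] --> l.
Proof.
move=> H; apply/cvgrPdist_le => e e0.
near=> x.
have x1 : 1 <= x by near: x; apply: nbhs_pinfty_ge; rewrite num_real.
have xC : `|C| / e <= x by near: x; apply: nbhs_pinfty_ge; rewrite num_real.
rewrite distrC (le_trans (H x x1))//.
rewrite ler_pdivrMr ?(lt_le_trans ltr01)//.
by rewrite ler_pdivrMr// mulrC in xC; rewrite (le_trans (ler_norm C)).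
Unshelve. all: by end_near. Qed.

(** Partial fractions for [y^4 + 4 = (y^2 + 2y + 2)(y^2 - 2y + 2)] give the primitive [F]. At
    infinity its logarithms cancel and its two arctangents contribute [pi / 8]. *)
Lemma integral_invD4 (R : realType) :
  (\int[lebesgue_measure]_(y in `[0%R, +oo[) ((y ^+ 4 + 4)^-1)%:E
   = (pi / 8 : R)%:E)%E.
Proof.
pose F (y : R) := 16^-1 * (ln (y ^+ 2 + 2 * y + 2) - ln (y ^+ 2 - 2 * y + 2))
   + 8^-1 * (atan (y + 1) + atan (y - 1)).
have p1 (y : R) : 0 < y ^+ 2 + 2 * y + 2.
  by have := sqr_ge0 (y + 1); nra.
have p2 (y : R) : 0 < y ^+ 2 - 2 * y + 2.
  by have := sqr_ge0 (y - 1); nra.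
have d4 (y : R) : y ^+ 4 + 4 != 0 by rewrite gt_eqF ?sqrD4_gt0.
have F0 : F 0 = 0.
  rewrite /F expr0n/= !mulr0 subr0 !addr0 subrr mulr0 add0r.
  by rewrite sub0r atanN add0r subrr mulr0.
have <- : pi / 8 - F 0 = pi / 8 by rewrite F0 subr0.
apply: ge0_FTC2_0y.
- by move=> y _; rewrite invr_ge0 ltW ?sqrD4_gt0.
- by apply: derivable_continuous => y; apply: derivableV.
- move=> y; rewrite /F.
  prove_derive; [exact: p1|exact: p2|].
  have h1 := lt0r_neq0 (p1 y). have h2 := lt0r_neq0 (p2 y).
  have h3 : 1 + (y + 1) ^+ 2 != 0 by rewrite (_ : _ + _ = y ^+ 2 + 2 * y + 2)//; ring.
  have h4 : 1 + (y - 1) ^+ 2 != 0 by rewrite (_ : _ + _ = y ^+ 2 - 2 * y + 2)//; ring.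
  have h5 := d4 y.
  rewrite /=; field; do ?[apply/andP; split] => //.
- have -> : pi / 8 = 16^-1 * 0 + 8^-1 * (pi / 2 + pi / 2) :> R by field.
  rewrite /F; apply: cvgD; apply: cvgM; try exact: cvg_cst.
    (* With [q] the quotient of the two quadratics, [0 <= ln q <= q - 1 = 4x / (x^2 - 2x + 2)]; this
       is at most [8 / x] because [(x - 2)^2 >= 0]. *)
    apply: (@cvgy_bounded_decay _ _ _ 8) => x x1; rewrite subr0.
    have x0 : 0 < x by lra.
    rewrite -ln_div ?posrE//.
    set q := _ / _.
    have q1 : 1 <= q by rewrite ler_pdivlMr// mul1r; nra.
    rewrite ger0_norm ?ln_ge0//.
    have := @le_ln1Dx _ (q - 1); rewrite addrCA subrr addr0 => H.
    rewrite (le_trans (H _))//; first by lra.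
    rewrite /q -[X in _ - X](@divff _ (x ^+ 2 - 2 * x + 2)) ?gt_eqF//.
    rewrite -mulrBl ler_pdivrMr// mulrAC ler_pdivlMr//.
    by have := sqr_ge0 (x - 2); nra.
  apply: cvgD.
    by apply: cvg_comp; [exact: (cvg_addrr 1)|exact: cvgy_atan].
  by apply: cvg_comp; [exact: (cvg_addrr (-1))|exact: cvgy_atan].
Qed.

Lemma expRNsqr_le (R : realType) (y : R) : expR (- y ^+ 2) <= (1 + y ^+ 2)^-1.
Proof.
rewrite expRN lef_pV2 ?posrE ?expR_gt0 ?expR_ge1Dx//.
by rewrite ltr_pwDl// sqr_ge0.
Qed.

Lemma continuous_measurable_EFin (R : realType) (f : R -> R) (D : set R) :
  continuous f -> measurable_fun D (fun x => (f x)%:E).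
Proof.
by move=> cf; apply/measurable_EFinP/measurable_funTS; exact: continuous_measurable_fun.
Qed.

Lemma integral_sqr_gauss (R : realType) :
  (\int[lebesgue_measure]_(y in `[0%R, +oo[) (y ^+ 2 * expR (- y ^+ 2))%:E
   = (Num.sqrt pi / 4 : R)%:E)%E.
Proof.
have D0 (y : R) : 0 < 1 + y ^+ 2 by rewrite ltr_pwDl// sqr_ge0.
(* [y exp(- y^2)] has derivative [(1 - 2 y^2) exp(- y^2)], of varying sign; adding
   [1 / (1 + y^2) >= exp(- y^2)] keeps all the integrands nonnegative. *)
pose h (y : R) := (2 * y ^+ 2 - 1) * expR (- y ^+ 2) + (1 + y ^+ 2)^-1.
have h0 y : 0 <= h y.
  have := expRNsqr_le _ y; rewrite /h; have := expR_ge0 (- y ^+ 2).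
  by have := sqr_ge0 y; nra.
have cf : continuous (fun y : R => 2 * (y ^+ 2 * expR (- y ^+ 2))).
  by apply: is_derive_continuous => y; derive_rules.
have cg : continuous (fun y : R => (1 + y ^+ 2)^-1).
  by apply: is_derive_continuous => y; derive_rules; exact: lt0r_neq0.
have ch : continuous h.
  move=> y; apply: cvgD; last exact: cg.
  have : continuous (fun y : R => (2 * y ^+ 2 - 1) * expR (- y ^+ 2)).
    by apply: is_derive_continuous => z; derive_rules.
  exact.
have Ih : (\int[lebesgue_measure]_(y in `[0%R, +oo[) (h y)%:E = (pi / 2)%:E)%E.
  pose F (y : R) := atan y - y * expR (- y ^+ 2).
  have <- : pi / 2 - F 0 = pi / 2 by rewrite /F atan0 mul0r !subr0.
  apply: ge0_FTC2_0y => //.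
  - move=> y; rewrite /F; prove_derive => /=.
    by rewrite /h; ring.
  - rewrite -[pi / 2]subr0; apply: cvgB; first exact: cvgy_atan.
    apply: (@cvgy_bounded_decay _ _ _ 1) => x x1; rewrite subr0.
    have x0 : 0 < x by lra.
    rewrite ger0_norm ?mulr_ge0 ?expR_ge0 ?(ltW x0)//.
    rewrite ler_pdivlMr// mulrAC -expr2.
    have := expRNsqr_le _ x; rewrite -(ler_pM2l (D0 x)) divff ?gt_eqF//.
    by have := expR_ge0 (- x ^+ 2); nra.
(* Pointwise, [2 y^2 exp(- y^2) + 1 / (1 + y^2) = h y + exp(- y^2)]; the integrals of all terms but
   the first are known. *)
have H : ((\int[lebesgue_measure]_(y in `[0%R, +oo[)
     (2 * (y ^+ 2 * expR (- y ^+ 2)))%:E) + (pi / 2 : R)%:E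
   = (pi / 2)%:E + (Num.sqrt pi / 2)%:E)%E.
  rewrite -[X in (_ + X = _)%E](integral0y_oneDsqr R) -integral0y_gauss -Ih.
  rewrite -!ge0_integralD//; first last.
  all: try exact: continuous_measurable_EFin.
  all: try by move=> y _; rewrite lee_fin invr_ge0 ltW.
  - move=> y _; rewrite lee_fin; apply: mulr_ge0 => //.
    by apply: mulr_ge0; [exact: sqr_ge0|exact: expR_ge0].
  - by apply: continuous_measurable_EFin; exact: continuous_gauss_fun.
  - by move=> y _; rewrite lee_fin expR_ge0.
  - by move=> y _; rewrite lee_fin; exact: h0.
  apply: eq_integral => y _; rewrite -!EFinD; congr (_%:E).
  by rewrite /h /gauss_fun /oneDsqr; ring.
have mG : continuous (fun y : R => (y ^+ 2 * expR (- y ^+ 2))).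
  by apply: is_derive_continuous => y; derive_rules.
move: H; under eq_integral do rewrite EFinM.
rewrite ge0_integralZl_EFin//; last 2 first.
- by move=> y _; rewrite lee_fin mulr_ge0 ?expR_ge0 ?sqr_ge0.
- exact: continuous_measurable_EFin.
case: (integral _ _ _) => [r| |]//.
rewrite -EFinM -!EFinD => -[] H; congr (_%:E); lra.
by rewrite mulry/= gtr0_sg// mul1e.
by rewrite mulrNy/= gtr0_sg// mul1e.
Qed.

(** Substitution of [x * y] for [y] in the previous integral. Divided by [x^3], this is the
    representation of [1 / x^3] used to unfold [sin(x^2)^2 / x^2]. *)
Lemma integral_sqr_gauss_scale (R : realType) (x : R) : 0 < x ->
  (\int[lebesgue_measure]_(y in `[0%R, +oo[)
     (x ^+ 3 * y ^+ 2 * expR (- (x ^+ 2 * y ^+ 2)))%:E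
   = (Num.sqrt pi / 4 : R)%:E)%E.
Proof.
move=> x0; rewrite -integral_sqr_gauss.
have dF : ((fun y => x * y)^`())%classic = cst x.
  apply/funext => y; rewrite derive1E.
  have -> : 'D_1 (fun y => x * y) y = x * 1 + y * 0.
    by apply: derive_val; derive_rules.
  by rewrite mulr1 mulr0 addr0.
have := @increasing_ge0_integration_by_substitutiony R (fun y => x * y)
   (fun y => y ^+ 2 * expR (- y ^+ 2)) 0.
rewrite mulr0 => ->//.
- apply: eq_integral => y _; congr (_%:E).
  rewrite dF /= fctE /= exprMn; ring.
- by move=> a b _ _ ab; rewrite ltr_pM2l.
- by rewrite dF => y _; exact: cvg_cst.
- by rewrite dF; exact: is_cvg_cst.
- by rewrite dF; exact: is_cvg_cst.
- split.
    by move=> y _; exact: ex_derive.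
  by apply: cvg_at_right_filter; apply: cvgM; [exact: cvg_cst|exact: cvg_id].
- by apply: gt0_cvgMry => //; exact: cvg_id.
- apply: continuous_subspaceT.
  by apply: is_derive_continuous => y; derive_rules.
- by move=> y _; rewrite mulr_ge0 ?expR_ge0 ?sqr_ge0.
Qed.

(** With [s = x^2] this is [p / 2] times the Laplace transform of [sin^2] at [p]; the primitive [F]
    comes from [sin^2 s = (1 - cos(2s)) / 2]. *)
Lemma integral_sin2_sqr_expR (R : realType) (p : R) : 0 < p ->
  (\int[lebesgue_measure]_(x in `[0%R, +oo[)
     (x * sin (x ^+ 2) ^+ 2 * p * expR (- (x ^+ 2 * p)))%:E
   = ((p ^+ 2 + 4)^-1 : R)%:E)%E.
Proof.
move=> p0.
have p4 : p ^+ 2 + 4 != 0 by rewrite gt_eqF// ltr_wpDl// sqr_ge0.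
pose f (x : R) := x * sin (x ^+ 2) ^+ 2 * p * expR (- (x ^+ 2 * p)).
pose F (x : R) := 4^-1 * p * expR (- (x ^+ 2 * p)) *
  (- p^-1 + (p * cos (2 * x ^+ 2) - 2 * sin (2 * x ^+ 2)) * (p ^+ 2 + 4)^-1).
have -> : (p ^+ 2 + 4)^-1 = 0 - F 0.
  rewrite /F expr0n/= mulr0 cos0 sin0 mul0r oppr0 expR0.
  by field; rewrite p4 gt_eqF.
apply: (ge0_FTC2_0y _ f F).
- move=> x x0; apply: mulr_ge0; last exact: expR_ge0.
  by apply: mulr_ge0; [apply: mulr_ge0; [|exact: sqr_ge0]|exact: ltW].
- by apply: is_derive_continuous => x; rewrite /f; derive_rules.
- move=> x; rewrite /F; prove_derive.
  have c2 : cos (2 * x ^+ 2) = 1 - 2 * sin (x ^+ 2) ^+ 2.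
    by rewrite mulr_natl cos_mulr2n cos2sin2; ring.
  by rewrite /f /= c2; field; rewrite p4 gt_eqF.
- apply: (cvgy_bounded_decay _ _ _ (4^-1 * (p^-1 + (p + 2) / (p ^+ 2 + 4)))).
  move=> x x1; rewrite subr0 /F.
  have x0 : 0 < x by lra.
  have D0 : 0 < p ^+ 2 + 4 by rewrite ltr_wpDl// sqr_ge0.
  (* The decay follows from [exp u >= 1 + u] at [u = x^2 p], where [x^2 p >= x p] since [x >= 1].
     The other factor of [F] is bounded uniformly in [x]. *)
  have E0 : p * expR (- (x ^+ 2 * p)) <= x^-1.
    have -> : x^-1 = p * (x * p)^-1 by field; rewrite !gt_eqF.
    rewrite ler_pM2l// expRN lef_pV2 ?posrE ?expR_gt0 ?mulr_gt0//.
    rewrite (le_trans _ (expR_ge1Dx _))//.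
    have : 0 <= (x - 1) * (x * p) 
      by apply: mulr_ge0; [lra|rewrite mulr_ge0 ?ltW].
    by lra.
  set E := p * expR _ in E0; set B := - p^-1 + _.
  have -> : 4^-1 * p * expR (- (x ^+ 2 * p)) * B = 4^-1 * (B * E).
    by rewrite /E; ring.
  have E1 : 0 <= E by rewrite mulr_ge0 ?expR_ge0 ?(ltW p0).
  rewrite -mulrA normrM (ger0_norm (_ : 0 <= 4^-1))// ler_pM2l//.
  rewrite normrM (ger0_norm E1) ler_pM// /B.
  rewrite (le_trans (ler_normD _ _))// normrN ger0_norm ?invr_ge0 ?(ltW p0)//.
  rewrite lerD2l normrM [X in _ * X]ger0_norm ?invr_ge0 ?(ltW D0)//.
  rewrite ler_pM2r ?invr_gt0// (le_trans (ler_normB _ _))//.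
  rewrite !normrM (ger0_norm (ltW p0)) (ger0_norm (_ : 0 <= 2 :> R))// lerD//.
    by rewrite ler_piMr ?(ltW p0)// cos_max.
  by rewrite ler_piMr// sin_max.
Qed.

(** * Exchange of integrals and the value of the limit integral *)

Lemma tonelli_0y (R : realType) (k : R -> R -> R) :
  measurable_fun setT (fun z : R * R => k z.1 z.2) ->
  (forall x y, 0 <= x -> 0 <= k x y) ->
  (\int[lebesgue_measure]_(x in `[0%R, +oo[)
     \int[lebesgue_measure]_(y in `[0%R, +oo[) (k x y)%:E =
   \int[lebesgue_measure]_(y in `[0%R, +oo[)
     \int[lebesgue_measure]_(x in `[0%R, +oo[) (k x y)%:E)%E.
Proof.
move=> mk k0.
pose D : set R := `[0%R, +oo[%classic.
(* Cutting off by indicators moves the problem to the whole plane, and makes the kernel nonnegative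
   also where [x < 0]. *)
pose K (z : R * R) := (k z.1 z.2 * (\1_D z.1 * \1_D z.2))%:E.
have mD : measurable_fun setT (\1_D : R -> R).
  by apply: measurable_indic; exact: measurable_itv.
have mK : measurable_fun setT K.
  apply/measurable_EFinP; apply: measurable_funM => //.
  by apply: measurable_funM; apply: measurableT_comp.
have K0 z : (0 <= K z)%E.
  rewrite lee_fin; rewrite !indicE; case: (boolP (z.1 \in D)) => [|_].
    by rewrite inE /D /= in_itv/= andbT => z0; rewrite !mulr_ge0// k0.
  by rewrite mul0r mulr0.
have mkcond (h : R -> \bar R) : (\int[lebesgue_measure]_(x in D) h x =
    \int[lebesgue_measure]_x (h x * (\1_D x)%:E))%E.
  by rewrite integral_mkcond; apply: eq_integral => x _; rewrite epatch_indic.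
have iter (h : R -> \bar R) (f : R -> R -> R) :
    (forall x, h x = \int[lebesgue_measure]_(y in D) (f x y)%:E)%E ->
    (\int[lebesgue_measure]_(x in D) h x = \int[lebesgue_measure]_x
      \int[lebesgue_measure]_y (f x y * (\1_D x * \1_D y))%:E)%E.
  move=> hE; rewrite mkcond; apply: eq_integral => x _.
  rewrite hE mkcond !indicE; case: (_ \in D).
    rewrite mule1; apply: eq_integral => y _.
    by rewrite mul1r EFinM.
  by rewrite mule0 integral0_eq// => y _; rewrite mul0r mulr0.
apply: (etrans (iter _ k (fun=> erefl))).
apply: (etrans (@fubini_tonelli _ _ _ _ R lebesgue_measure lebesgue_measure K mK K0)).
apply: (etrans _ (esym (iter _ (fun y x => k x y) (fun=> erefl)))).
apply: eq_integral => y _; apply: eq_integral => x _.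
by rewrite /K/= [X in _ * X]mulrC.
Qed.

Lemma measurable_sin2_sqr_div_sqr (R : realType) :
  measurable_fun setT (fun x : R => sin (x ^+ 2) ^+ 2 / x ^+ 2).
Proof.
apply: measurable_funM.
  apply: continuous_measurable_fun.
  by apply: is_derive_continuous => y; derive_rules.
(* As a real power the inverse is measurable on the whole line; both sides are 0 at [x = 0]. *)
rewrite (_ : (fun x => _) = (fun x : R => (x ^+ 2) `^ (- 1))); last first.
  by apply/funext => x; rewrite powR_inv1 ?sqr_ge0.
exact: (@measurableT_comp _ _ _ _ _ _ (fun y : R => y `^ (- 1)) _
  (fun x : R => x ^+ 2)).
Qed.

Lemma integral_sin2_sqr_div_sqr (R : realType) :
  (\int[lebesgue_measure]_(x in `[0%R, +oo[) (sin (x ^+ 2) ^+ 2 / x ^+ 2)%:E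
   = (Num.sqrt pi / 2 : R)%:E)%E.
Proof.
pose c : R := Num.sqrt pi / 4.
have spi0 : 0 < Num.sqrt pi :> R by rewrite sqrtr_gt0 pi_gt0.
have c0 : 0 < c by rewrite divr_gt0.
(* Integrated over [y] this gives [c * sin(x^2)^2 / x^2]; integrated over [x], with [p = y^2], it
   gives [1 / (y^4 + 4)]. *)
pose k (x y : R) := x * sin (x ^+ 2) ^+ 2 * y ^+ 2 * expR (- (x ^+ 2 * y ^+ 2)).
have mk : measurable_fun setT (fun z : R * R => k z.1 z.2).
  apply: measurable_funM.
    apply: measurable_funM.
      apply: (@measurableT_comp _ _ _ _ _ _
        (fun x : R => x * sin (x ^+ 2) ^+ 2) _ fst) => //.
      apply: continuous_measurable_fun.
      by apply: is_derive_continuous => y; derive_rules.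
    exact: measurable_funX.
  apply: (@measurableT_comp _ _ _ _ _ _ (@expR R)) => //.
  apply: measurable_funN; apply: measurable_funM; exact: measurable_funX.
have k0 x y : 0 <= x -> 0 <= k x y.
  move=> x0; apply: mulr_ge0; last exact: expR_ge0.
  by apply: mulr_ge0; [apply: mulr_ge0; [|exact: sqr_ge0]|exact: sqr_ge0].
have := @tonelli_0y R k mk k0.
have -> : (\int[lebesgue_measure]_(x in `[0%R, +oo[)
     \int[lebesgue_measure]_(y in `[0%R, +oo[) (k x y)%:E =
   c%:E * \int[lebesgue_measure]_(x in `[0%R, +oo[) (sin (x ^+ 2) ^+ 2 / x ^+ 2)%:E)%E.
  rewrite -ge0_integralZl_EFin//; last 3 first.
  - by move=> x _; rewrite lee_fin divr_ge0 ?sqr_ge0.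
  - by apply/measurable_EFinP/measurable_funTS; exact: measurable_sin2_sqr_div_sqr.
  - exact: ltW.
  apply: eq_integral => x; rewrite inE/= in_itv/= andbT le_eqVlt => /predU1P[<-|x0].
    rewrite expr0n/= sin0 expr0n mul0r mule0 integral0_eq// => y _.
    by rewrite /k mul0r !mul0r.
  rewrite -(integral_sqr_gauss_scale _ x x0).
  rewrite -ge0_integralZr//; last 3 first.
  - apply: continuous_measurable_EFin.
    by apply: is_derive_continuous => y; derive_rules.
  - move=> y _; rewrite lee_fin; apply: mulr_ge0; last exact: expR_ge0.
    by apply: mulr_ge0; [rewrite exprn_ge0 ?(ltW x0)|exact: sqr_ge0].
  - by rewrite lee_fin divr_ge0 ?sqr_ge0.
  apply: eq_integral => y _; rewrite -EFinM /k; congr (_%:E).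
  by field; rewrite gt_eqF.
have -> : (\int[lebesgue_measure]_(y in `[0%R, +oo[)
     \int[lebesgue_measure]_(x in `[0%R, +oo[) (k x y)%:E = (pi / 8 : R)%:E)%E.
  (* The point [y = 0] has to be left out: there the kernel vanishes while [1 / (y^4 + 4)] is
     [1 / 4]. A single point does not change the outer integral. *)
  have inner y : y \in (`]0%R, +oo[%classic : set R) ->
      (\int[lebesgue_measure]_(x in `[0%R, +oo[) (k x y)%:E = ((y ^+ 4 + 4)^-1)%:E)%E.
    rewrite inE/= in_itv/= andbT => y0.
    by rewrite integral_sin2_sqr_expR ?exprn_gt0// -exprM.
  have mD4 : measurable_fun (`]0%R, +oo[ : set R) (fun y : R => ((y ^+ 4 + 4)^-1)%:E).
    apply: continuous_measurable_EFin.
    by apply: is_derive_continuous => y; derive_rules; rewrite gt_eqF// sqrD4_gt0.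
  rewrite -integral_invD4 -!(@integral_itv_obnd_cbnd _ 0%R +oo%O)//.
  - exact: eq_integral.
  - by apply: eq_measurable_fun mD4 => y /inner ->.
(* The two orders give [c * J = pi / 8] for the unknown extended real [J]; since [c > 0], an
   infinite [J] is impossible. *)
case: (integral _ _ _) => [r| |].
- rewrite -EFinM => -[] H; congr (_%:E).
  apply: (mulfI (lt0r_neq0 c0)); rewrite H /c -[in LHS](sqr_sqrtr (pi_ge0 R)).
  by field.
- by rewrite mulry/= gtr0_sg// mul1e.
- by rewrite mulrNy/= gtr0_sg// mul1e.
Qed.

(** * Riemann sums *)

Lemma sin_mean_value (R : realType) (t : R) : 0 <= t ->
  exists2 c, 0 <= c <= t & sin t = t * cos c.
Proof.
move=> t0; have [c|c] := @MVT_segment R sin cos 0 t t0 _.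
  by apply: continuous_subspaceT => x; exact: continuous_sin.
rewrite in_itv/= sin0 !subr0 => ct E; exists c => //.
by rewrite E mulrC.
Qed.

Lemma sin_le (R : realType) (t : R) : 0 <= t -> sin t <= t.
Proof.
by move=> t0; have [c _ ->] := @sin_mean_value R t t0; rewrite ler_piMr// cos_le1.
Qed.

Lemma sqr_sin_le (R : realType) (t : R) : 0 <= t -> sin t ^+ 2 <= t ^+ 2.
Proof.
move=> t0; have [c _ ->] := @sin_mean_value R t t0.
by rewrite exprMn ler_piMr ?sqr_ge0.
Qed.

Lemma mul_cos_le_sin (R : realType) (t : R) : 0 <= t <= pi -> t * cos t <= sin t.
Proof.
move=> /andP[t0 tpi]; have [c /andP[c0 ct] ->] := @sin_mean_value R t t0.
rewrite ler_wpM2l//; move: ct; rewrite le_eqVlt => /predU1P[->//|ct].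
by apply/ltW; rewrite ltr_cos// in_itv/= ?t0 ?tpi ?c0//= (le_trans (ltW ct)).
Qed.

(** With [s = t / 2]: [sin t = 2 sin s cos s >= 2 s cos^2 s = s (1 + cos t) >= s], the last step
    because [cos t >= 0]. *)
Lemma half_le_sin (R : realType) (t : R) : 0 <= t <= pi / 2 -> t / 2 <= sin t.
Proof.
move=> /andP[t0 tpi]; pose s := t / 2.
have s0 : 0 <= s by rewrite divr_ge0.
have st : t = s *+ 2 by rewrite /s -mulr_natl; field.
have c2 : 0 <= cos t.
  apply: cos_ge0_pihalf; rewrite tpi andbT (le_trans _ t0)// oppr_le0.
  by rewrite divr_ge0// pi_ge0.
have cs : 0 <= cos s.
  apply: cos_ge0_pihalf; have := pi_ge0 R; rewrite /s; lra.
have ss : s * cos s <= sin s.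
  by apply: mul_cos_le_sin; have := pi_ge0 R; rewrite s0 /s/=; lra.
rewrite -/s st sin_mulr2n; move: c2; rewrite st cos_mulr2n => c2.
have h1 : 0 <= cos s * (sin s - s * cos s) by rewrite mulr_ge0// subr_ge0.
have h2 : 0 <= s * (cos s ^+ 2 *+ 2 - 1) by rewrite mulr_ge0.
by lra.
Qed.

(* With [d = sqrt (pi / n)] this is [(pi / n) |sin (pi u^2 / n) / sin (pi u / n)|^2]. *)
Definition lobe {R : realType} (d : R) (u : nat) : R :=
  d ^+ 2 * (sin ((u%:R * d) ^+ 2) / sin (u%:R * d ^+ 2)) ^+ 2.

Lemma lobe_ge0 (R : realType) (d : R) u : 0 <= lobe d u.
Proof. by rewrite mulr_ge0// sqr_ge0. Qed.

(** Supplies the integrable majorant for dominated convergence. Bounding the denominator below by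
    half its angle gives [4 sin(x^2)^2 / x^2] at the node [x = u d]. *)
Lemma lobe_le (R : realType) (d : R) u : 0 < d -> (0 < u)%N ->
  u%:R * d ^+ 2 <= pi / 2 -> lobe d u <= 8 / (1 + (u%:R * d) ^+ 2).
Proof.
move=> d0 u0 ud; pose x := u%:R * d.
have ur : 0 < u%:R :> R by rewrite ltr0n.
have x0 : 0 < x by rewrite mulr_gt0.
have D0 : 0 < 1 + x ^+ 2 by rewrite ltr_pwDl// sqr_ge0.
have v0 : 0 < u%:R * d ^+ 2 by rewrite mulr_gt0// exprn_gt0.
set v := u%:R * _ in ud v0.
have sv : v / 2 <= sin v by apply: half_le_sin; rewrite ud ltW.
have xvd : x * d = v by rewrite /x /v; ring.
have H : lobe d u <= 4 * sin (x ^+ 2) ^+ 2 / x ^+ 2.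
  rewrite /lobe -/v -/x expr_div_n.
  have -> : 4 * sin (x ^+ 2) ^+ 2 / x ^+ 2 = d ^+ 2 * (sin (x ^+ 2) ^+ 2 / (v / 2) ^+ 2).
    by rewrite -xvd; field; rewrite !gt_eqF.
  rewrite ler_pM2l ?exprn_gt0// ler_wpM2l ?sqr_ge0//.
  rewrite lef_pV2 ?posrE ?exprn_gt0 ?divr_gt0//.
    rewrite lerXn2r ?nnegrE// ?divr_ge0 ?(ltW v0)//.
    by rewrite (le_trans _ sv)// divr_ge0// ltW.
  by rewrite (lt_le_trans _ sv)// divr_gt0.
rewrite (le_trans H)// -/x.
have s1 : sin (x ^+ 2) ^+ 2 <= 1 by rewrite sin2cos2 gerBl sqr_ge0.
have s2 : sin (x ^+ 2) ^+ 2 <= x ^+ 2 * x ^+ 2 by rewrite -expr2 sqr_sin_le ?sqr_ge0.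
rewrite ler_pdivlMr// mulrAC ler_pdivrMr ?exprn_gt0//.
set s := sin _ ^+ 2 in s1 s2 *. set y := x ^+ 2 in s1 s2 *.
have y0 : 0 <= y by rewrite sqr_ge0.
have s0 : 0 <= s by rewrite sqr_ge0.
(* For [y <= 1] the bound [s <= y^2] suffices, for [y > 1] the bound [s <= 1]. *)
have [y1|y1] := leP y 1; nra.
Qed.

Definition step_fun {R : realType} (d : R) (N : nat) (a : nat -> R) (x : R) : R :=
  \sum_(0 <= u < N) a u * \1_(`[u%:R * d, u.+1%:R * d[%classic : set R) x.

Lemma step_funE (R : realType) (d : R) (N : nat) (a : nat -> R) (x : R) :
  0 < d -> 0 <= x ->
  step_fun d N a x = if (Num.truncn (x / d) < N)%N then a (Num.truncn (x / d)) else 0.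
Proof.
move=> d0 x0; set m := Num.truncn _.
have indE u : \1_(`[u%:R * d, u.+1%:R * d[%classic : set R) x = (u == m)%:R :> R.
  rewrite indicE; congr (_%:R); rewrite eq_sym /m truncn_eq ?divr_ge0 ?(ltW d0)//.
  rewrite ler_pdivlMr// ltr_pdivrMr//.
  by rewrite mem_setE in_itv.
rewrite /step_fun; under eq_bigr do rewrite indE mulr_natr mulrb.
by rewrite -big_mkcond big_nat1_eq.
Qed.

Lemma integral_step_fun (R : realType) (d : R) (N : nat) (a : nat -> R) :
  0 <= d -> (forall u, 0 <= a u) ->
  (\int[lebesgue_measure]_(x in `[0%R, +oo[) (step_fun d N a x)%:E
   = (d * \sum_(0 <= u < N) a u)%:E)%E.
Proof.
move=> d0 a0; rewrite /step_fun.
under eq_integral do rewrite -sumEFin.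
rewrite ge0_integral_sum//; last first.
- by move=> u x _; rewrite lee_fin mulr_ge0.
- move=> u; apply/measurable_EFinP; apply: measurable_funM => //.
rewrite mulr_sumr -sumEFin; apply: eq_bigr => u _.
under eq_integral do rewrite EFinM.
rewrite ge0_integralZl_EFin//; last first.
  apply/measurable_EFinP; apply: measurable_indic; exact: measurable_itv.
rewrite integral_indic//=.
rewrite (_ : _ `&` _ = `[u%:R * d, u.+1%:R * d[%classic); last first.
  apply/seteqP; split => x /=; first by case.
  rewrite !in_itv/= andbT => xu; split => //.
  by case/andP: xu => xu _; rewrite (le_trans _ xu)// mulr_ge0.
rewrite lebesgue_measure_itv/= lte_fin.
have -> : u.+1%:R * d = u%:R * d + d by rewrite -natr1 mulrDl mul1r.
rewrite ltrDl -EFinB addrAC subrr add0r.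
move: d0; rewrite le_eqVlt => /predU1P[<-|->]; last by rewrite -EFinM mulrC.
by rewrite ltxx mule0 mul0r.
Qed.

Lemma measurable_step_fun (R : realType) (d : R) (N : nat) (a : nat -> R) :
  measurable_fun setT (step_fun d N a).
Proof.
by apply: measurable_sum => u; apply: measurable_funM.
Qed.

(** Once [v <= pi], the quotient [sin v / v] is squeezed between [cos v] and 1. *)
Lemma cvg_div_sin (R : realType) (v : nat -> R) : (forall n, 0 < v n) ->
  v @ \oo --> (0 : R) -> v n / sin (v n) @[n --> \oo] --> (1 : R).
Proof.
move=> v0 vc.
have H : sin (v n) / v n @[n --> \oo] --> (1 : R).
  apply: (@squeeze_cvgr _ _ _ _ (fun n => cos (v n)) (cst 1)).
  - near=> n; have vpi : v n <= pi.
      near: n; apply: (cvgr_le 0) => //; exact: pi_gt0.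
    rewrite ler_pdivlMr// ler_pdivrMr// mul1r sin_le ?(ltW (v0 n))// andbT mulrC.
    by rewrite mul_cos_le_sin// vpi ltW.
  - by rewrite -(cos0 R); apply: (cvg_comp v cos vc); exact: continuous_cos.
  - exact: cvg_cst.
rewrite (_ : (fun n => v n / _) = fun n => (sin (v n) / v n)^-1); last first.
  by apply/funext => n; rewrite invf_div.
by rewrite -[X in _ --> X]invr1; apply: cvgV => //; exact: oner_neq0.
Unshelve. all: by end_near. Qed.

Lemma integrable_div_oneDsqr (R : realType) (c : R) :
  lebesgue_measure.-integrable (`]0%R, +oo[%classic : set R)
    (fun x => (c / (1 + x ^+ 2))%:E).
Proof.
have D0 (y : R) : 0 < 1 + y ^+ 2 by rewrite ltr_pwDl// sqr_ge0.
pose g (x : R) := (1 + x ^+ 2)^-1.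
have cg : continuous g.
  by apply: is_derive_continuous => y; derive_rules; exact: lt0r_neq0.
have mg (D : set R) : measurable_fun D (fun x => (g x)%:E).
  exact: continuous_measurable_EFin.
rewrite (_ : (fun x => _) = (fun x => c%:E * (g x)%:E)%E)//.
apply: integrableZl; first exact: measurable_itv.
apply/integrableP; split; first exact: mg.
set I := integral _ _ _; have -> : I = (pi / 2)%:E by [
  rewrite /I -integral0y_oneDsqr -integral_itv_obnd_cbnd//;
  apply: eq_integral => x _; rewrite /= ger0_norm// invr_ge0 ltW].
exact: ltry.
Qed.

(** * Dominated convergence of the sums of lobes *)

Section lobe_sums.
Variables (R : realType) (d : nat -> R) (N : nat -> nat).
Hypotheses (d0 : forall n, 0 < d n) (dc : d @ \oo --> (0 : R)).
Hypothesis Nle : forall n, (N n)%:R * d n ^+ 2 <= pi / 2.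
Hypothesis Nge : forall n, pi / 2 <= (N n).+1%:R * d n ^+ 2.

(** Each cell carries the value at its right endpoint: this avoids the degenerate node 0, and lets a
    decreasing majorant at the node be replaced by its value at [x]. *)
Let f n := step_fun (d n) (N n) (fun u => lobe (d n) u.+1).

(** Let [y n] be the right endpoint of the cell of [x], and [v = y n * d n]. The value of [f n] is
    eventually [sin(y^2)^2 / y^2 * (v / sin v)^2], with [y n] tending to [x] and [v] to 0. *)
Lemma cvg_step_fun_lobe (x : R) : 0 < x ->
  f n x @[n --> \oo] --> sin (x ^+ 2) ^+ 2 / x ^+ 2.
Proof.
move=> x0.
pose m n := Num.truncn (x / d n).
pose y n := (m n).+1%:R * d n.
have xd n : 0 <= x / d n by rewrite divr_ge0// ltW.
have my n : x < y n <= x + d n.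
  have /andP[h1 h2] := truncn_itv (xd n).
  rewrite /y -ltr_pdivrMr// h2/= -natr1 mulrDl mul1r lerD2r.
  by rewrite -ler_pdivlMr.
have y0 n : 0 < y n by case/andP: (my n) => + _; exact: lt_trans.
have yc : y @ \oo --> x.
  apply: (@squeeze_cvgr _ _ _ _ (cst x) (fun n => x + d n)).
  - by near=> n; case/andP: (my n) => /ltW -> ->.
  - exact: cvg_cst.
  - by rewrite -[X in _ --> X]addr0; apply: cvgD => //; exact: cvg_cst.
have ydc : y n * d n @[n --> \oo] --> (0 : R).
  by rewrite -[X in _ --> X](mulr0 x); exact: cvgM.
have ch : {for x, continuous (fun x : R => sin (x ^+ 2) ^+ 2 / x ^+ 2)}.
  have [df dh] : exists df, is_derive x (1 : R) (fun x => sin (x ^+ 2) ^+ 2 / x ^+ 2) df.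
    by eexists; derive_rules; rewrite expf_neq0// gt_eqF.
  by apply/differentiable_continuous/derivable1_diffP; exact: ex_derive.
have H : sin (y n ^+ 2) ^+ 2 / y n ^+ 2 * (y n * d n / sin (y n * d n)) ^+ 2 @[n --> \oo]
    --> sin (x ^+ 2) ^+ 2 / x ^+ 2.
  rewrite -[X in _ --> X]mulr1; apply: cvgM.
    apply: (cvg_comp y (fun x : R => sin (x ^+ 2) ^+ 2 / x ^+ 2) yc);
      exact: ch.
  have yd1 : y n * d n / sin (y n * d n) @[n --> \oo] --> (1 : R).
    by apply: cvg_div_sin => // n; rewrite mulr_gt0.
  rewrite -[X in _ --> X](expr1n _ 2).
  by apply: (cvg_comp _ (fun x : R => x ^+ 2) yd1); exact: exprn_continuous.
apply: cvg_trans H; apply: near_eq_cvg; near=> n.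
rewrite /f step_funE ?(ltW x0)// -/(m n).
(* A cell beyond the cutoff would force [y n * d n >= pi / 2] by [Nge], but this product tends to
   0. *)
have -> : (m n < N n)%N.
  rewrite ltnNge; apply/negP => Nm.
  have : y n * d n < pi / 2.
    by near: n; apply: (cvgr_lt 0) => //; rewrite divr_gt0// pi_gt0.
  apply/negP; rewrite -leNgt (le_trans (Nge n))// /y -mulrA -expr2.
  by rewrite ler_pM2r ?exprn_gt0// ler_nat.
rewrite /lobe -/(y n) (_ : _ * d n ^+ 2 = y n * d n); last by rewrite /y; ring.
move: (sin (y n * d n))^-1 => w.
by field; rewrite gt_eqF.
Unshelve. all: by end_near. Qed.

Lemma step_fun_lobe_le n x : 0 < x -> `|f n x| <= 8 / (1 + x ^+ 2).
Proof.
move=> x0.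
have D0 (y : R) : 0 < 1 + y ^+ 2 by rewrite ltr_pwDl// sqr_ge0.
rewrite /f step_funE ?(ltW x0)//; set m := Num.truncn _; case: ifPn => mN; last first.
  by rewrite normr0 divr_ge0// ltW.
rewrite ger0_norm ?lobe_ge0// (le_trans (lobe_le _ _ _ (d0 n) (ltn0Sn _) _))//.
  by rewrite (le_trans _ (Nle n))// ler_pM2r ?exprn_gt0// ler_nat.
rewrite ler_pM2l// lef_pV2 ?posrE// lerD2l lerXn2r ?nnegrE ?(ltW x0)//.
  by rewrite mulr_ge0 ?(ltW (d0 n)).
rewrite -ler_pdivrMr// ltW//.
have xd : 0 <= x / d n by rewrite divr_ge0// ltW.
by case/andP: (truncn_itv xd).
Qed.

Lemma cvg_sum_lobe :
  d n * (\sum_(0 <= u < N n) lobe (d n) u.+1) @[n --> \oo] --> Num.sqrt pi / 2.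
Proof.
pose D : set R := `]0%R, +oo[%classic.
have mD : measurable D by exact: measurable_itv.
pose h (x : R) := sin (x ^+ 2) ^+ 2 / x ^+ 2.
have mf n : measurable_fun D (fun x => (f n x)%:E).
  by apply/measurable_EFinP/measurable_funTS; exact: measurable_step_fun.
have mh : measurable_fun D (fun x => (h x)%:E).
  by apply/measurable_EFinP/measurable_funTS; exact: measurable_sin2_sqr_div_sqr.
have fh : {ae lebesgue_measure, forall x, D x ->
    (f n x)%:E @[n --> \oo] --> (h x)%:E}.
  apply: aeW => x; rewrite /D/= in_itv/= andbT => x0.
  by apply: cvg_EFin; [exact: nearW|exact: cvg_step_fun_lobe].
have fg : {ae lebesgue_measure, forall x n, D x ->
    (`|(f n x)%:E| <= (8 / (1 + x ^+ 2))%:E)%E}.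
  apply: aeW => x n; rewrite /D/= in_itv/= andbT => x0.
  by rewrite /= lee_fin; exact: step_fun_lobe_le.
have [_ _] := @dominated_convergence _ _ R (@lebesgue_measure R) D mD
  (fun n x => (f n x)%:E) (fun x => (h x)%:E) (fun x => (8 / (1 + x ^+ 2))%:E)
  mf mh fh (integrable_div_oneDsqr _ 8) fg.
rewrite /D integral_itv_obnd_cbnd// integral_sin2_sqr_div_sqr => H.
(* The scaled sum is the integral of the step function [f n]; the endpoint 0 is negligible. *)
rewrite (_ : (fun n => d n * _) = (fun n =>
    fine (\int[lebesgue_measure]_(x in `]0%R, +oo[) (f n x)%:E))); last first.
  apply/funext => n; rewrite integral_itv_obnd_cbnd; last exact: mf.
  by rewrite integral_step_fun//; [exact: ltW|move=> u; exact: lobe_ge0].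
exact: fine_cvg H.
Qed.

End lobe_sums.

(** * Norms of the polynomials *)

(** The left side is the squared modulus of the sum of [exp(i th k)]; the right side groups the
    pairs of indices by their difference [u.+1]. *)
Lemma sqr_sum_cos_sin (R : realType) (th : nat -> R) (m : nat) :
  (\sum_(0 <= k < m.+1) cos (th k)) ^+ 2 + (\sum_(0 <= k < m.+1) sin (th k)) ^+ 2
  = m.+1%:R + 2 * \sum_(0 <= u < m) \sum_(0 <= k < m - u) cos (th (k + u.+1)%N - th k).
Proof.
elim: m => [|m IH].
  by rewrite !big_nat1 cos2Dsin2 big_geq// mulr0 addr0.
rewrite !(big_nat_recr m.+1)//=.
set C := \sum_(0 <= i < m.+1) cos _ in IH *; set S := \sum_(0 <= i < m.+1) sin _ in IH *.
(* The new index [m.+1] adds exactly one pair, [(m - u, m.+1)], to each difference [u.+1]; the class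
   [u = m] was empty before. *)
have -> : \sum_(0 <= u < m.+1) \sum_(0 <= k < m.+1 - u) cos (th (k + u.+1)%N - th k)
   = (\sum_(0 <= u < m) \sum_(0 <= k < m - u) cos (th (k + u.+1)%N - th k))
     + \sum_(0 <= i < m.+1) cos (th m.+1 - th i).
  rewrite [in X in _ + X]big_nat_rev/= add0n.
  rewrite (eq_big_nat _ _ (F2 := fun u => \sum_(0 <= k < m - u) cos (th (k + u.+1)%N - th k)
     + cos (th m.+1 - th (m.+1 - u.+1)%N))); last first.
    move=> u /andP[_ um]; rewrite subSn// big_nat_recr//=.
    by rewrite subSS addnS subnK.
  by rewrite big_split/= big_nat_recr//= subnn (@big_geq _ _ _ 0 0)// addr0.
rewrite mulrDr addrA.
have -> : m.+2%:R + 2 * (\sum_(0 <= u < m) \sum_(0 <= k < m - u)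
      cos (th (k + u.+1)%N - th k)) = C ^+ 2 + S ^+ 2 + 1 by rewrite IH -[m.+2%:R]natr1; ring.
have -> : \sum_(0 <= i < m.+1) cos (th m.+1 - th i) = cos (th m.+1) * C + sin (th m.+1) * S.
  by rewrite /C /S !mulr_sumr -big_split/=; apply: eq_bigr => i _; rewrite cosB.
by have := cos2Dsin2 (th m.+1); lra.
Qed.

(** The real part of a geometric sum with ratio [exp(2 i b)]. The factor [sin b] stays on the left,
    which keeps the induction free of division. *)
Lemma sum_cos_arith (R : realType) (a b : R) (m : nat) :
  (\sum_(0 <= k < m) cos (a + k%:R * (2 * b))) * sin b
  = sin (m%:R * b) * cos (a + m%:R * b - b).
Proof.
elim: m => [|m IH]; first by rewrite big_geq// !mul0r sin0 mul0r.
rewrite big_nat_recr//= mulrDl IH -[m.+1%:R]natr1.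
have -> : a + m%:R * (2 * b) = a + m%:R * b + m%:R * b by ring.
have -> : a + (m%:R + 1) * b - b = a + m%:R * b by ring.
rewrite [(m%:R + 1) * b]mulrDl mul1r.
move: (m%:R * b) (a + m%:R * b) => x y.
by rewrite cosB sinD cosD; ring.
Qed.

Lemma sin_natpi (R : realType) (u : nat) : sin (u%:R * pi) = 0 :> R.
Proof.
by elim: u => [|u IH]; [rewrite mul0r sin0|rewrite -natr1 mulrDl mul1r sinDpi IH oppr0].
Qed.

(** The real amplitude of the autocorrelation at shift [u], up to a phase: the Dirichlet quotient
    [sin((n - u) b) / sin b] at [b = pi u / n], from a geometric sum of [n - u] terms. *)
Definition corr_coef {R : realType} (n u : nat) : R :=
  sin ((n - u)%:R * (pi * u%:R / n%:R)) / sin (pi * u%:R / n%:R).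

(** The angle [(n - u) pi u / n] equals [u pi - pi u^2 / n], so the two numerators agree up to
    sign. *)
Lemma sqr_corr_coef (R : realType) (n u : nat) : (u <= n)%N -> (0 < n)%N ->
  corr_coef n u ^+ 2
  = (sin (pi * (u ^ 2)%:R / n%:R) / sin (pi * u%:R / n%:R)) ^+ 2 :> R.
Proof.
move=> un n0; rewrite /corr_coef !expr_div_n; congr (_ / _).
have -> : (n - u)%:R * (pi * u%:R / n%:R) = u%:R * pi - pi * (u ^ 2)%:R / n%:R :> R.
  by rewrite natrB// natrX; field; rewrite pnatr_eq0 -lt0n.
rewrite sinB sin_natpi mul0r sub0r sqrrN exprMn cos2sin2 sin_natpi.
by rewrite expr0n subr0 mul1r.
Qed.

Lemma sin_frac_pi_gt0 (R : realType) (n u : nat) : (0 < u < n)%N ->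
  0 < sin (pi * u%:R / n%:R) :> R.
Proof.
move=> /andP[u0 un]; have n0 : 0 < n%:R :> R by rewrite ltr0n (ltn_trans u0).
apply: sin_gt0_pi; apply/andP; split.
  by rewrite divr_gt0// mulr_gt0 ?pi_gt0// ltr0n.
by rewrite ltr_pdivrMr// ltr_pM2l ?pi_gt0// ltr_nat.
Qed.

(** The phase is quadratic in [k], so its differences at a fixed shift are arithmetic progressions
    and each inner sum is geometric. *)
Lemma sqr_modulus_chirp (R : realType) (m : nat) (t : R) :
  let th k := pi * (k ^ 2)%:R / m.+1%:R + k%:R * t in
  (\sum_(0 <= k < m.+1) cos (th k)) ^+ 2 + (\sum_(0 <= k < m.+1) sin (th k)) ^+ 2
  = m.+1%:R + 2 * \sum_(0 <= u < m)
      corr_coef m.+1 u.+1 * cos (u.+1%:R * (t + (pi - pi / m.+1%:R))).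
Proof.
move=> th; rewrite sqr_sum_cos_sin; congr (_ + 2 * _).
apply: eq_big_nat => u /andP[_ um].
have n0 : m.+1%:R != 0 :> R by rewrite pnatr_eq0.
have s0 : 0 < sin (pi * u.+1%:R / m.+1%:R) :> R by exact: sin_frac_pi_gt0.
apply: (mulIf (lt0r_neq0 s0)).
rewrite /corr_coef [RHS]mulrAC divfK ?gt_eqF//.
under eq_big_nat => k _.
  have -> : th (k + u.+1)%N - th k = (pi * (u.+1 ^ 2)%:R / m.+1%:R + u.+1%:R * t)
     + k%:R * (2 * (pi * u.+1%:R / m.+1%:R)).
    by rewrite /th !natrX natrD; field.
  over.
rewrite sum_cos_arith subSS; congr (_ * cos _).
(* The terms [pi u^2 / n] cancel in the central phase, so every frequency has the same translation
   of [t], and orthogonality applies directly. *)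
by rewrite natrB ?(ltnW um)// natrX -!natr1; field; rewrite natr1.
Qed.

(** * Orthogonality of cosines over a period *)

Section trigonometric_integrals.
Variable R : realType.
Implicit Types (f g : R -> R).
Local Notation circle := (`[0%R, (2 * pi)%R]%classic : set R).
Local Notation I f := (\int[lebesgue_measure]_(t in circle) f t).

Lemma circle_integrable f : continuous f ->
  lebesgue_measure.-integrable circle (EFin \o f).
Proof.
move=> cf; apply: continuous_compact_integrable; first exact: segment_compact.
exact: continuous_subspaceT.
Qed.

Lemma circle_integralD f g : continuous f -> continuous g ->
  I (fun t => f t + g t) = I f + I g.
Proof.
by move=> cf cg; rewrite RintegralD//; exact: circle_integrable.
Qed.

Lemma circle_integralZ c f : continuous f -> I (fun t => c * f t) = c * I f.
Proof. by move=> cf; rewrite RintegralZl//; exact: circle_integrable. Qed.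

Lemma circle_integral_cst c : I (fun=> c) = c * (2 * pi).
Proof.
rewrite Rintegral_cst//= lebesgue_measure_itv/= lte_fin mulr_gt0 ?pi_gt0//.
by rewrite -EFinB subr0.
Qed.

Lemma continuous_sum (F : nat -> R -> R) m :
  (forall u, continuous (F u)) -> continuous (fun t => \sum_(0 <= u < m) F u t).
Proof.
move=> cF; elim: m => [|m IH].
  by under eq_fun do rewrite big_geq//; move=> t; exact: cvg_cst.
under eq_fun do rewrite big_nat_recr//=.
by move=> t; apply: cvgD; [exact: IH|exact: cF].
Qed.

Lemma circle_integral_sum (F : nat -> R -> R) m : (forall u, continuous (F u)) ->
  I (fun t => \sum_(0 <= u < m) F u t) = \sum_(0 <= u < m) I (F u).
Proof.
move=> cF; elim: m => [|m IH].
  under eq_Rintegral do rewrite big_geq//.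
  by rewrite circle_integral_cst mul0r big_geq.
under eq_Rintegral do rewrite big_nat_recr//=.
by rewrite circle_integralD ?IH ?big_nat_recr//; exact: continuous_sum.
Qed.

Lemma continuous_cos_shift (k : nat) (phi : R) :
  continuous (fun t : R => cos (k%:R * (t + phi))).
Proof. by apply: is_derive_continuous => t; derive_rules. Qed.

Lemma sin_shift_period (k : nat) (x : R) : sin (x + k%:R * (2 * pi)) = sin x.
Proof.
have -> : x + k%:R * (2 * pi) = x + (pi *+ 2) *+ k.
  by rewrite -[_ *+ 2 *+ k]mulr_natl -[pi *+ 2]mulr_natl.
by rewrite (periodicn (@sinD2pi R)).
Qed.

Lemma circle_integral_cos (k : nat) (phi : R) : (0 < k)%N ->
  I (fun t => cos (k%:R * (t + phi))) = 0.
Proof.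
move=> k0; have kr : k%:R != 0 :> R by rewrite pnatr_eq0 -lt0n.
pose F (t : R) := k%:R^-1 * sin (k%:R * (t + phi)).
have dF (t : R) : is_derive t (1 : R) F (cos (k%:R * (t + phi))).
  by rewrite /F; prove_derive => /=; field.
have cF := is_derive_continuous _ _ dF.
rewrite /Rintegral (@continuous_FTC2 R _ F)//.
- rewrite -EFinB/= /F.
  have -> : k%:R * (2 * pi + phi) = k%:R * (0 + phi) + k%:R * (2 * pi) by ring.
  by rewrite sin_shift_period subrr.
- by rewrite mulr_gt0// pi_gt0.
- by apply: continuous_subspaceT; exact: continuous_cos_shift.
- split; first by move=> t _; exact: ex_derive.
    by apply: cvg_at_right_filter; exact: cF.
  by apply: cvg_at_left_filter; exact: cF.
- by move=> t _; rewrite derive1E derive_val.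
Qed.

Lemma circle_integral_cos_cos (u v : nat) (phi : R) :
  I (fun t => cos (u.+1%:R * (t + phi)) * cos (v.+1%:R * (t + phi)))
  = if u == v then pi else 0.
Proof.
(* Ordering the indices makes the truncated difference [u - v] a true frequency for the
   product-to-sum formula. *)
wlog uv : u v / (v <= u)%N => [H|].
  have [|/ltnW] := leqP v u; first exact: H.
  by move/H; rewrite eq_sym => <-; apply: eq_Rintegral => t _; rewrite mulrC.
transitivity (I (fun t => 2^-1 * cos ((u - v)%:R * (t + phi))
    + 2^-1 * cos ((u.+1 + v.+1)%:R * (t + phi)))).
  apply: eq_Rintegral => t _.
  have -> : (u - v)%:R * (t + phi) = u.+1%:R * (t + phi) - v.+1%:R * (t + phi).
    by rewrite -subSS natrB// mulrBl.
  by rewrite natrD mulrDl cosB cosD; field.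
have cc k : continuous (fun t : R => 2^-1 * cos (k%:R * (t + phi))).
  by apply: is_derive_continuous => t; derive_rules.
rewrite circle_integralD// !circle_integralZ; try exact: continuous_cos_shift.
rewrite [X in _ + _ * X]circle_integral_cos// mulr0 addr0.
case: eqVneq => [->|nuv]; last first.
  by rewrite circle_integral_cos ?mulr0// subn_gt0 ltn_neqAle eq_sym nuv.
rewrite subnn; under eq_Rintegral do rewrite mul0r cos0.
by rewrite circle_integral_cst; field.
Qed.

Variables (m : nat) (c phi : R) (r : nat -> R).
Let P t := c + 2 * \sum_(0 <= u < m) r u * cos (u.+1%:R * (t + phi)).
Let Q t := \sum_(0 <= u < m) r u * cos (u.+1%:R * (t + phi)).

Let cr u : continuous (fun t => r u * cos (u.+1%:R * (t + phi))).
Proof. by apply: is_derive_continuous => t; derive_rules. Qed.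

Let cQ : continuous Q. Proof. exact: continuous_sum. Qed.

Let IQ : I Q = 0.
Proof.
rewrite circle_integral_sum//; apply: big1 => u _.
rewrite circle_integralZ; last exact: continuous_cos_shift.
by rewrite circle_integral_cos ?mulr0.
Qed.

Lemma circle_integral_cos_poly : I P = 2 * pi * c.
Proof.
rewrite /P circle_integralD; [|by move=> t; exact: cvg_cst|].
  by rewrite circle_integralZ// -/Q IQ circle_integral_cst; ring.
by move=> t; apply: cvgM; [exact: cvg_cst|exact: cQ].
Qed.

(** Parseval's identity: in [(c + 2 Q)^2] the cross term has mean zero, and in [Q^2] only the
    diagonal products survive, each contributing [pi]. *)
Lemma circle_integral_sqr_cos_poly :
  I (fun t => P t ^+ 2) = 2 * pi * (c ^+ 2 + 2 * \sum_(0 <= u < m) r u ^+ 2).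
Proof.
have cQQ : continuous (fun t => Q t * Q t).
  by move=> t; apply: cvgM; exact: cQ.
have IQQ : I (fun t => Q t * Q t) = pi * \sum_(0 <= u < m) r u ^+ 2.
  transitivity (I (fun t => \sum_(0 <= u < m) \sum_(0 <= v < m)
      r u * r v * (cos (u.+1%:R * (t + phi)) * cos (v.+1%:R * (t + phi))))).
    apply: eq_Rintegral => t _; rewrite /Q mulr_suml; apply: eq_bigr => u _.
    by rewrite mulr_sumr; apply: eq_bigr => v _; ring.
  have cc u v : continuous (fun t => cos (u.+1%:R * (t + phi)) * cos (v.+1%:R * (t + phi))).
    by apply: is_derive_continuous => t; derive_rules.
  have crr u v : continuous (fun t => r u * r v *
      (cos (u.+1%:R * (t + phi)) * cos (v.+1%:R * (t + phi)))).
    by apply: is_derive_continuous => t; derive_rules.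
  rewrite circle_integral_sum; last by move=> u; exact: continuous_sum.
  rewrite mulr_sumr; apply: eq_big_nat => u /andP[_ um].
  rewrite circle_integral_sum//.
  under eq_bigr do rewrite circle_integralZ// circle_integral_cos_cos mulrC
    -mulrb mulrnAl mulrb eq_sym.
  by rewrite -big_mkcond big_nat1_eq um expr2.
transitivity (I (fun t => c ^+ 2 + (4 * c * Q t + 4 * (Q t * Q t)))).
  by apply: eq_Rintegral => t _; rewrite /P -/(Q t); ring.
have c4 : continuous (fun t => 4 * c * Q t).
  by move=> t; apply: cvgM; [exact: cvg_cst|exact: cQ].
have c4' : continuous (fun t => 4 * (Q t * Q t)).
  by move=> t; apply: cvgM; [exact: cvg_cst|exact: cQQ].
rewrite circle_integralD; [|by move=> t; exact: cvg_cst|]; last first.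
  by move=> t; apply: cvgD; [exact: c4|exact: c4'].
rewrite circle_integral_cst circle_integralD// !circle_integralZ//.
by rewrite -[I (fun t => Q t)]/(I Q) IQ IQQ; ring.
Qed.

End trigonometric_integrals.

(** * The second and fourth norms of the chirp polynomial *)

Lemma expiD (R : realType) (s t : R) : expi (s + t) = expi s * expi t.
Proof.
apply/eqP; rewrite eq_complex /= cosD sinD eqxx /=.
by apply/eqP; ring.
Qed.

Lemma expiX (R : realType) (t : R) k : expi t ^+ k = expi (k%:R * t).
Proof.
elim: k => [|k IH]; first by rewrite expr0 mul0r /expi cos0 sin0.
by rewrite exprSr IH -expiD -natr1 mulrDl mul1r.
Qed.

Lemma sqr_normc_g_poly (R : realType) (m : nat) (t : R) :
  ComplexField.Normc.normc (g_poly R m.+1).[expi t] ^+ 2 =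
  m.+1%:R + 2 * \sum_(0 <= u < m)
      corr_coef m.+1 u.+1 * cos (u.+1%:R * (t + (pi - pi / m.+1%:R))).
Proof.
pose th k := pi * (k ^ 2)%:R / m.+1%:R + k%:R * t.
rewrite -sqr_modulus_chirp -/th /g_poly horner_sum.
under eq_bigr do rewrite hornerZ hornerXn expiX -expiD -/(th _).
have -> n : \sum_(0 <= k < n) expi (th k) =
   ((\sum_(0 <= k < n) cos (th k)) +i* (\sum_(0 <= k < n) sin (th k)))%C.
  elim: n => [|n IH]; first by rewrite !big_geq.
  by rewrite !big_nat_recr//= IH.
by rewrite /= sqr_sqrtr// addr_ge0// sqr_ge0.
Qed.

Lemma circle_norm_pow (R : realType) (k : nat) (f : {poly R[i]}) : (0 < k)%N ->
  circle_norm k%:R f ^+ k = (2 * pi)^-1 *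
   \int[lebesgue_measure]_(t in `[0%R, (2 * pi)%R]%classic)
     (ComplexField.Normc.normc f.[expi t] ^+ k).
Proof.
move=> k0; rewrite /circle_norm.
set J := Rintegral _ _ _; have J0 : 0 <= J.
  by apply: Rintegral_ge0 => t _; exact: powR_ge0.
rewrite -powR_mulrn ?powR_ge0// -powRrM mulVf ?pnatr_eq0 -?lt0n// powRr1; last first.
  by rewrite mulr_ge0// invr_ge0 mulr_ge0// pi_ge0.
congr (_ * _); apply: eq_Rintegral => t _.
by rewrite powR_mulrn//; case: (f.[_]) => a b; exact: sqrtr_ge0.
Qed.

Lemma circle_norm2_g_poly (R : realType) (m : nat) :
  circle_norm 2 (g_poly R m.+1) ^+ 2 = m.+1%:R.
Proof.
rewrite circle_norm_pow//; under eq_Rintegral do rewrite sqr_normc_g_poly.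
by rewrite circle_integral_cos_poly mulKf// gt_eqF// mulr_gt0 ?pi_gt0.
Qed.

Lemma circle_norm4_g_poly (R : realType) (m : nat) :
  circle_norm 4 (g_poly R m.+1) ^+ 4 =
  m.+1%:R ^+ 2 + 2 * \sum_(0 <= u < m) corr_coef m.+1 u.+1 ^+ 2.
Proof.
rewrite circle_norm_pow//.
under eq_Rintegral do rewrite (exprM _ 2 2) sqr_normc_g_poly.
by rewrite circle_integral_sqr_cos_poly mulKf// gt_eqF// mulr_gt0 ?pi_gt0.
Qed.

(** * Symmetry of the correlations and passage to the limit *)

Lemma sum_symmetric_halves (V : zmodType) (t : nat -> V) (m : nat) :
  (forall u, (u < m)%N -> t u = t (m - u.+1)%N) ->
  \sum_(0 <= u < m) t u = \sum_(0 <= u < m.+1./2) t u + \sum_(0 <= u < m./2) t u.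
Proof.
move=> sym; have hm : (m.+1./2 <= m)%N by lia.
have mh : (m - m.+1./2)%N = m./2 by lia.
move: m.+1./2 hm mh => h hm mh.
(* For odd [m] the middle term goes to the first block; the second block, read backwards, is the sum
   of the first [m./2] terms by symmetry. *)
rewrite (big_cat_nat (leq0n _) hm)/=; congr (_ + _).
rewrite big_nat_rev/= -{1}[h]add0n big_addn mh.
apply: eq_big_nat => u /andP[_ um].
rewrite [RHS]sym; last by lia.
by congr t; lia.
Qed.

(** The numerator's angle [(n - u) u pi / n] is symmetric, and the denominator's angle is reflected
    to its supplement. *)
Lemma corr_coef_sym (R : realType) (n u : nat) : (u < n)%N ->
  corr_coef n (n - u) = corr_coef n u :> R.
Proof.
move=> un; have n0 : n%:R != 0 :> R by rewrite pnatr_eq0; lia.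
have E : pi * (n - u)%:R / n%:R = pi - pi * u%:R / n%:R :> R.
  by rewrite natrB ?(ltnW un)//; move: (@pi R) => p; field.
rewrite /corr_coef subKn ?(ltnW un)//; congr (sin _ / _).
  by move: (@pi R) => p; ring.
by rewrite E sinB sinpi cospi mul0r sub0r mulN1r opprK.
Qed.

Theorem theorem1 (R : realType) :
  (fun n : nat =>
     (circle_norm 4 (g_poly R n) ^+ 4 - circle_norm 2 (g_poly R n) ^+ 4)
       / circle_norm 2 (g_poly R n) ^+ 3) @ \oo --> (2 / pi : R).
Proof.
(* From here on the degree parameter is [n = m.+1], which is positive, and the shifts run over the
   [m] values from 1 to [n - 1]. *)
rewrite -cvg_shiftS /=.
pose d m : R := Num.sqrt (pi / m.+1%:R).
have n0 m : 0 < m.+1%:R :> R by rewrite ltr0n.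
have pi0 : 0 < pi :> R := pi_gt0 R.
have pin0 m : 0 < pi / m.+1%:R :> R by rewrite divr_gt0.
have d0 m : 0 < d m by rewrite sqrtr_gt0.
have d2 m : d m ^+ 2 = pi / m.+1%:R by rewrite sqr_sqrtr// ltW.
have dc : d @ \oo --> (0 : R).
  rewrite -(sqrtr0 R).
  have hc : pi / n.+1%:R @[n --> \oo] --> (0 : R).
    by rewrite -[X in _ --> X](mulr0 pi); apply: cvgM; [exact: cvg_cst|exact: cvg_harmonic].
  by apply: (cvg_comp _ Num.sqrt hc); exact: sqrt_continuous.
have Nle (N : nat -> nat) : (forall m, (N m).*2 <= m.+1)%N ->
    forall m, (N m)%:R * d m ^+ 2 <= pi / 2.
  move=> H m; rewrite d2 mulrA ler_pdivrMr// mulrAC ler_pdivlMr//.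
  rewrite -mulrA mulrC -mulrA ler_pM2l// mulrC -natrM ler_nat muln2; exact: H.
have Nge (N : nat -> nat) : (forall m, m.+1 <= (N m).+1.*2)%N ->
    forall m, pi / 2 <= (N m).+1%:R * d m ^+ 2.
  move=> H m; rewrite d2 mulrA ler_pdivlMr// mulrAC ler_pdivrMr//.
  rewrite [(N m).+1%:R * pi]mulrC -mulrA ler_pM2l// -natrM ler_nat muln2; exact: H.
(* Since [d^2 = pi / n], the condition [2 N <= n <= 2 (N + 1)] places the cutoff at angle [pi / 2];
   both the rounded-up and the rounded-down half of [m] satisfy it. *)
have half (N : nat -> nat) : (forall m, (N m).*2 <= m.+1 <= (N m).+1.*2)%N ->
    d m * (\sum_(0 <= u < N m) lobe (d m) u.+1) @[m --> \oo] --> Num.sqrt pi / 2.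
  move=> H; apply: cvg_sum_lobe => //.
  - by apply: Nle => m; case/andP: (H m).
  - by apply: Nge => m; case/andP: (H m).
have spi_neq0 : Num.sqrt pi != 0 :> R by rewrite gt_eqF// sqrtr_gt0.
have pi_neq0 : pi != 0 :> R := lt0r_neq0 pi0.
have h1 := half (fun m => m.+1./2) ltac:(by move=> m; lia).
have h2 := half (fun m => m./2) ltac:(by move=> m; lia).
have <- : 2 / (pi * Num.sqrt pi) * (Num.sqrt pi / 2 + Num.sqrt pi / 2) = 2 / pi :> R.
  move: spi_neq0 pi_neq0; move: (Num.sqrt pi) => s; move: (@pi R) => p s0 p0.
  by field; rewrite p0 s0.
(* With [S] the sum of squared correlations, the ratio is [2 S / n^(3/2)]. Since
   [d^3 = pi^(3/2) / n^(3/2)], it equals [2 d^3 S / (pi sqrt pi)], and two factors [d] are absorbed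
   in the lobes. *)
rewrite (_ : (fun n : nat => _ / _) = fun m => 2 / (pi * Num.sqrt pi) *
    (d m * (\sum_(0 <= u < m.+1./2) lobe (d m) u.+1)
     + d m * (\sum_(0 <= u < m./2) lobe (d m) u.+1))); last first.
  apply/funext => m.
  have := circle_norm4_g_poly R m; have := circle_norm2_g_poly R m.
  have : 0 <= circle_norm 2 (g_poly R m.+1) by exact: powR_ge0.
  move: (circle_norm 2 _) (circle_norm 4 _) => nrm nrm4 nrm0 nrm2 ->.
  have nrmE : d m * nrm = Num.sqrt pi.
    have -> : nrm = Num.sqrt m.+1%:R by rewrite -nrm2 sqrtr_sqr ger0_norm.
    by rewrite /d -sqrtrM ?ltW// divfK ?gt_eqF.
  have lobeE u : (u <= m)%N -> lobe (d m) u = d m ^+ 2 * corr_coef m.+1 u ^+ 2.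
    move=> um; rewrite /lobe sqr_corr_coef//; last exact: leqW.
    have -> : (u%:R * d m) ^+ 2 = pi * (u ^ 2)%:R / m.+1%:R.
      by rewrite exprMn d2 natrX mulrCA mulrA.
    by have -> : u%:R * d m ^+ 2 = pi * u%:R / m.+1%:R by rewrite d2 mulrCA mulrA.
  rewrite -mulrDr -sum_symmetric_halves; last first.
    move=> u um.
    rewrite !lobeE//; last by lia.
    rewrite (_ : (m - u.+1).+1 = (m.+1 - u.+1)%N); last by lia.
    by rewrite corr_coef_sym.
  have -> : \sum_(0 <= u < m) lobe (d m) u.+1 =
      d m ^+ 2 * \sum_(0 <= u < m) corr_coef m.+1 u.+1 ^+ 2.
    by rewrite mulr_sumr; apply: eq_big_nat => u /andP[_ um]; exact: lobeE.
  have nrm_neq0 : nrm != 0.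
    by apply/eqP => nrm00; have := n0 m; rewrite -nrm2 nrm00 expr0n ltxx.
  (* Expressing [n], [d m] and [pi] through [nrm] and [sqrt pi] turns the claim into an identity of
     rational functions. *)
  have dE : d m = Num.sqrt pi / nrm by rewrite -nrmE mulfK.
  have pE : pi = Num.sqrt pi ^+ 2 :> R by rewrite sqr_sqrtr// ltW.
  rewrite -nrm2 dE; set S := \sum_(0 <= u < m) _.
  move: pE spi_neq0 S; move: (Num.sqrt pi) => s pE s0 S; rewrite pE.
  by field; rewrite nrm_neq0 s0.
apply: cvgM; first exact: cvg_cst.
exact: cvgD.
Qed.
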